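(* Let $p$ be a prime and let $F$ be a free pro-$p$ group of rank greater than $1$. Then $F$ is cancellable in the category of profinite groups: for all profinite groups $A,B$, if $F\times A\cong F\times B$ then $A\cong B$.
   Context: All homomorphisms and isomorphisms between profinite groups are continuous. The free pro-$p$ group of rank $\kappa$ (a possibly infinite cardinal) is the free pro-$p$ group on a set of cardinality $\kappa$ converging to $1$. *)

(* Defs.v *)
From HB Require Import structures.
From mathcomp Require Import all_boot.
From mathcomp Require Import boolp classical_sets functions cardinality.
From mathcomp Require Import topology.

Set Implicit Arguments.
Unset Strict Implicit.
Unset Printing Implicit Defensive.

Local Open Scope classical_set_scope.
Local Open Scope card_scope.
Local Open Scope group_scope.

HB.mixin Record Group_isTopologicalGroup G of Topological G & Group G := {
  mulg_continuous : continuous (fun x : G * G => x.1 * x.2) ;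
  invg_continuous : continuous (fun x : G => x^-1)
}.

#[short(type="topologicalGroupType")]
HB.structure Definition TopologicalGroup :=
  {G of Topological G & Group G & Group_isTopologicalGroup G}.

Section ProductGroup.
Variables G H : topologicalGroupType.

Let prod_mulg_continuous :
  continuous (fun x : (G * H) * (G * H) => x.1 * x.2).
Proof.
move=> [[a b] [c d]]; apply: cvg_pair => /=.
- apply: (@cvg_comp _ _ _ (fun y : (G * H) * (G * H) => (y.1.1, y.2.1))
    (fun z : G * G => z.1 * z.2) _ (nbhs (a, c))); last exact: (mulg_continuous (a, c)).
  apply: cvg_pair => /=.
  + by apply: cvg_comp; exact: cvg_fst.
  + by apply: cvg_comp; [exact: cvg_snd | exact: cvg_fst].
- apply: (@cvg_comp _ _ _ (fun y : (G * H) * (G * H) => (y.1.2, y.2.2))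
    (fun z : H * H => z.1 * z.2) _ (nbhs (b, d))); last exact: (mulg_continuous (b, d)).
  apply: cvg_pair => /=.
  + by apply: cvg_comp; [exact: cvg_fst | exact: cvg_snd].
  + by apply: cvg_comp; exact: cvg_snd.
Qed.

Let prod_invg_continuous : continuous (fun x : G * H => x^-1).
Proof.
move=> [a b]; apply: cvg_pair => /=.
- by apply: cvg_comp; [exact: cvg_fst | exact: invg_continuous].
- by apply: cvg_comp; [exact: cvg_snd | exact: invg_continuous].
Qed.

HB.instance Definition _ := Group_isTopologicalGroup.Build (G * H)%type
  prod_mulg_continuous prod_invg_continuous.

End ProductGroup.

Definition profinite (G : topologicalGroupType) : Prop :=
  [/\ compact [set: G], hausdorff_space G & totally_disconnected [set: G]].

Definition continuous_hom (G H : topologicalGroupType) (f : G -> H) : Prop :=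
  {morph f : x y / x * y} /\ continuous f.

Definition top_isomorphic (G H : topologicalGroupType) : Prop :=
  exists (f : G -> H) (g : H -> G),
    [/\ continuous_hom f, continuous_hom g, cancel f g & cancel g f].

Definition normal_subgroup (G : topologicalGroupType) (N : set G) : Prop :=
  group_closed [in N] /\ forall x y : G, N x -> N (x ^ y).

Definition left_cosets (G : topologicalGroupType) (N : set G) : set (set G) :=
  [set [set x * n | n in N] | x in [set: G]].

Definition pro_p (p : nat) (G : topologicalGroupType) : Prop :=
  profinite G /\
  forall N : set G, open N -> normal_subgroup N ->
    exists k : nat, left_cosets N #= `I_(p ^ k)%N.

Definition converges_to_1 (X : Type) (G : topologicalGroupType) (f : X -> G)
    : Prop :=
  forall U : set G, nbhs (1 : G) U -> cofinite_set (f @^-1` U).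

(* [iota] need not be assumed injective nor its image generating: for [p] prime
   both follow from the universal property. *)
Definition is_free_pro_p (p : nat) (F : topologicalGroupType) (X : Type)
    (iota : X -> F) : Prop :=
  [/\ pro_p p F,
      converges_to_1 iota
    & forall (G : topologicalGroupType) (f : X -> G),
        pro_p p G -> converges_to_1 f ->
        exists! phi : F -> G, continuous_hom phi /\ phi \o iota = f].

(* Free pro-[p] of rank the cardinal of [X]. *)
Definition free_pro_p_of_rank (p : nat) (F : topologicalGroupType) (X : Type)
    : Prop :=
  exists iota : X -> F, is_free_pro_p p iota.

Definition profinite_cancellable (F : topologicalGroupType) : Prop :=
  forall A B : topologicalGroupType, profinite A -> profinite B ->
    top_isomorphic (F * A)%type (F * B)%type -> top_isomorphic A B.

(* Main.v *)
Require Import Defs.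
From mathcomp Require Import all_boot all_fingroup all_algebra all_solvable.
From mathcomp Require Import boolp classical_sets functions cardinality.
From mathcomp Require Import topology.
From HB Require Import structures.

(** Write [F * A = F' * B] with [F'] isomorphic to [F].  The projections of [F']
    and of [B] to [F] commute elementwise and their product is [F]; the point is
    that one of them must then be trivial, after which the isomorphism
    between [A] and [B] is written down explicitly.

    Let [F = N M] with [N] and [M] commuting.  If neither factor is dense, there
    are continuous characters [a], [b] of [F] to the field with [p] elements,
    [a] killing [M] but not [N], and [b] killing [N] but not [M].  As [F] is
    free, [(a, b)] lifts to the Heisenberg group over that field, where the
    images of some [n] in [N] and [m] in [M] do not commute.  If, say, [M] is
    dense, then [N] is central, and central elements are trivial: given [z <> 1]
    and a finite quotient [Q] of [F] in which [z] survives, let [C] be cyclic of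
    order [p #|Q|] and lift [F -> Q] to the wreath product of the prime field
    with [Q * C], sending one generator to (delta, (x, 1)) and another to
    (0, (y, g)), with [g] generating [C].  If [(v, k)] is the image of [z], the
    second generator forces [v] to be invariant under [(y, g)], hence to have sum
    zero over each coset of [C]; summing over [C] the relation given by the first
    generator yields [0 = 1]. *)

Set Implicit Arguments.
Unset Strict Implicit.
Unset Printing Implicit Defensive.
Import GRing.Theory.
Local Open Scope classical_set_scope.
Local Open Scope group_scope.

(** * Separating points of profinite groups by open normal subgroups *)

(** If [P] and [Q] split the intersection [K] into closed parts with [x] in [P], normality gives an
    open [O] around [P] whose closure misses [Q]. Compactness then cuts [O] down to a clopen
    neighbourhood of [x] missing [Q], so [K] misses [Q]. *)
Lemma quasi_component_connected (T : topologicalType) (x : T) :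
  compact [set: T] -> hausdorff_space T ->
  connected (\bigcap_(C in [set C | clopen C /\ C x]) C).
Proof.
move=> cT hT; set K := \bigcap_(C in _) C.
have clK : closed K by apply: closed_bigI => C [[]].
have split0 (P Q : set T) : closed P -> closed Q -> P `&` Q = set0 ->
    P `|` Q = K -> P x -> Q = set0.
  move=> clP clQ PQ0 PQK Px.
  have [O [oO PO OQ]] : exists O : set T, [/\ open O, P `<=` O & closure O `<=` ~` Q].
    have nQ : set_nbhs P (~` Q).
      apply/set_nbhsP; exists (~` Q); split => //; first exact: closed_openC.
      exact/disjoints_subset.
    have [U nU UQ] := compact_normal hT cT clP nQ.
    have [O [oO PO OU]] := (set_nbhsP _ _).1 nU.
    exists O; split => //; apply: subset_trans UQ; exact: closureS.
  pose W := O `|` ~` closure O.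
  have KW : K `<=` W.
    move=> y; rewrite -PQK => -[/PO|Qy]; [by left|right].
    by move=> /OQ.
  have oW : open W by apply: openU => //; apply: closed_openC; exact: closed_closure.
  (* Otherwise the closed sets [C \ W] generate a proper filter; a cluster point of it lies in every
     [C], hence in [K], but not in [W]. *)
  have [C [[clC Cx] CW]] : exists C, (clopen C /\ C x) /\ C `<=` W.
    apply: contrapT => nC.
    pose F := filter_from [set C : set T | clopen C /\ C x] (fun C => C `\` W).
    have FF : Filter F.
      apply: filter_from_filter; first by exists setT; split => //; exact: clopenT.
      move=> A B [cA Ax] [cB Bx]; exists (A `&` B); first by split => //; exact: clopenI.
      by move=> y [[]].
    have PF : ProperFilter F.
      apply: filter_from_proper => C cC; apply: contrapT => nCW; apply: nC.
      exists C; split => // y Cy; apply: contrapT => nWy; apply: nCW.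
      by exists y.
    have [|y [_ yF]] := cT F PF; first exact: filterT.
    have inC C : clopen C -> C x -> C y /\ ~ W y.
      move=> cC Cx.
      have : closed (C `\` W).
        by apply: closedI; [exact: cC.2|exact: open_closedC].
      apply => U nU; apply: yF => //; by exists C.
    have [_ nWy] := inC setT clopenT I.
    by apply: nWy; apply: KW => C [cC Cx]; have [] := inC _ cC Cx.
  (* Inside [W] no point lies on the boundary of [O], so [O] and its closure have the same trace on
     [C]. *)
  have clCO : clopen (C `&` O).
    split; first by apply: openI => //; exact: clC.1.
    suff -> : C `&` O = C `&` closure O.
      by apply: closedI; [exact: clC.2|exact: closed_closure].
    apply/seteqP; split=> y [Cy Oy]; split => //; first exact: subset_closure.
    by case: (CW _ Cy).
  apply: contrapT => /eqP/set0P[y Qy].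
  have : K y by rewrite -PQK; right.
  move=> /(_ (C `&` O)) [|_ Oy]; first by split => //; split => //; exact: PO.
  exact: (OQ y (subset_closure Oy)).
move=> B B0 [C1 oC1 BC1] [C2 clC2 BC2].
have clB : closed B by rewrite BC2; exact: closedI.
have clD : closed (K `&` ~` C1) by apply: closedI => //; exact: open_closedC.
have BD0 : B `&` (K `&` ~` C1) = set0.
  by rewrite BC1; apply/seteqP; split=> y // [[_ ?] [_]].
have BDK : B `|` (K `&` ~` C1) = K.
  apply/seteqP; split=> y; first by rewrite BC1 => -[[]|[]].
  by rewrite BC1 => Ky; case: (pselect (C1 y)) => ?; [left|right].
have Kx : K x by move=> C [].
have [Bx|nBx] := pselect (B x).
  have D0 := split0 _ _ clB clD BD0 BDK Bx.
  by rewrite -BDK D0 setU0.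
have B0' : B = set0.
  apply: (split0 (K `&` ~` C1) B clD clB); [by rewrite setIC|by rewrite setUC|].
  by split=> // C1x; apply: nBx; rewrite BC1.
by case: B0 => y; rewrite B0'.
Qed.

Lemma totally_disconnected_zero_dimensional (T : topologicalType) :
  compact [set: T] -> hausdorff_space T -> totally_disconnected [set: T] ->
  zero_dimensional T.
Proof.
move=> cT hT dT x y /eqP xy; apply: contrapT => nC; apply: xy.
have : connected_component [set: T] x y.
  exists (\bigcap_(C in [set C | clopen C /\ C x]) C).
    by split => //; [move=> C [] | exact: quasi_component_connected].
  move=> C [cC Cx]; apply: contrapT => nCy; apply: nC; by exists C.
by rewrite dT //= => ->.
Qed.

Lemma hom1 (G H : groupType) (f : G -> H) : {morph f : x y / x * y} -> f 1 = 1.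
Proof. by move=> fM; apply: (mulgI (f 1)); rewrite -fM !mulg1. Qed.

Lemma continuousMg (T : topologicalType) (G : topologicalGroupType)
    (f g : T -> G) (x : T) :
  {for x, continuous f} -> {for x, continuous g} ->
  {for x, continuous (fun y => f y * g y)}.
Proof.
move=> cf cg; apply: (@cvg_comp _ _ _ (fun y => (f y, g y))
  (fun z : G * G => z.1 * z.2) _ (nbhs (f x, g x))); first exact: cvg_pair.
exact: (mulg_continuous (f x, g x)).
Qed.

(** Some clopen [C] contains [1] and misses [z]. If inserting elements of [N] anywhere in a product
    never changes membership in [C], then [N] cannot contain [z]. *)
Lemma profinite_separated (G : topologicalGroupType) (z : G) :
  profinite G -> z <> 1 ->
  exists N : set G, [/\ open N, normal_subgroup N & ~ N z].
Proof.
move=> [cG hG dG] /eqP z1.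
have [C [[oC clC] C1 nCz]] :=
  totally_disconnected_zero_dimensional cG hG dG (ltac:(by rewrite eq_sym) : 1 != z).
(* The syntactic kernel of [C]: normal by construction, open by compactness. *)
pose N := [set x : G | forall a b : G, C (a * x * b) <-> C (a * b)].
have N1 : N 1 by move=> a b; rewrite mulg1.
have NM x y : N x -> N y -> N (x * y).
  move=> Nx Ny a b; rewrite mulgA; rewrite (Ny (a * x)); exact: Nx.
have NV x : N x -> N x^-1.
  move=> Nx a b; have := Nx a (x^-1 * b).
  by rewrite -(mulgA a x) mulVKg mulgA => Nab; split => /Nab.
have nN : nbhs (1 : G) N.
  (* Tube lemma: as [C] and its complement are open, the condition holds near [((a, b), 1)] for each
     pair; compactness makes the neighbourhood of [1] uniform in [(a, b)]. *)
  have /compact_near_coveringP cGG : compact [set: G * G].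
    by rewrite -setXTT; exact: compact_setX.
  have : \forall x \near (1 : G), [set: G * G] `<=`
      [set ab | C (ab.1 * x * ab.2) <-> C (ab.1 * ab.2)].
    apply: cGG => -[a b] _ /=.
    pose l (y : (G * G) * G) := y.1.1 * y.2 * y.1.2.
    pose r (y : (G * G) * G) := y.1.1 * y.1.2.
    have c11 : {for ((a, b), (1 : G)), continuous (fun y : (G * G) * G => y.1.1)}.
      by apply: cvg_comp; [exact: cvg_fst|exact: cvg_fst].
    have c12 : {for ((a, b), (1 : G)), continuous (fun y : (G * G) * G => y.1.2)}.
      by apply: cvg_comp; [exact: cvg_fst|exact: cvg_snd].
    have c2 : {for ((a, b), (1 : G)), continuous (fun y : (G * G) * G => y.2)}.
      exact: cvg_snd.
    have cl : {for ((a, b), (1 : G)), continuous l}.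
      by apply: continuousMg c12; exact: (continuousMg c11 c2).
    have cr : {for ((a, b), (1 : G)), continuous r} by exact: continuousMg.
    have lr : l ((a, b), 1) = r ((a, b), 1) by rewrite /l /r mulg1.
    have [Cab|nCab] := pselect (C (a * b)).
      have nC : nbhs (a * b) C by apply: open_nbhs_nbhs.
      have nl : nbhs ((a, b), (1 : G)) (l @^-1` C) by apply: cl; rewrite lr.
      have nr : nbhs ((a, b), (1 : G)) (r @^-1` C) by apply: cr.
      by apply: filterS2 nl nr => y.
    have nC : nbhs (a * b) (~` C).
      by apply: open_nbhs_nbhs; split => //; exact: closed_openC.
    have nl : nbhs ((a, b), (1 : G)) (l @^-1` (~` C)) by apply: cl; rewrite lr.
    have nr : nbhs ((a, b), (1 : G)) (r @^-1` (~` C)) by apply: cr.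
    by apply: filterS2 nl nr => y.
  by apply: filterS => x Nx a b; exact: (Nx (a, b)).
have gN : group_closed [in N].
  split; first exact/mem_set.
  by move=> x y /set_mem Nx /set_mem Ny; apply/mem_set/NM/NV.
exists N; split.
- rewrite openE => x Nx; rewrite /interior.
  have cx : {for x, continuous (fun y : G => x^-1 * y)}.
    by apply: continuousMg; [exact: cvg_cst|exact: cvg_id].
  have : nbhs x [set y | N (x^-1 * y)] by apply: cx; rewrite mulVg.
  by apply: filterS => y Ny; rewrite -(mulVKg x y); apply: NM.
- split=> // x y Nx a b.
  by have := Nx (a * y^-1) (y * b); rewrite conjgE !mulgA mulgVK.
- by move=> /(_ 1 1); rewrite mul1g !mulg1 => -[_ /(_ C1)].
Qed.

(** * Finite quotients *)

Lemma normal_subgroup_closed (G : topologicalGroupType) (N : set G) :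
  normal_subgroup N ->
  [/\ N 1, forall x y, N x -> N y -> N (x * y), forall x, N x -> N x^-1
    & forall x y, N x -> N (x ^ y)].
Proof.
move=> [gN nN]; split=> //; first exact/set_mem/gN.1.
  by move=> x y Nx Ny; apply/set_mem/(group_closedM gN); apply/mem_set.
by move=> x Nx; apply/set_mem/(group_closedV gN)/mem_set.
Qed.

Definition discrete_group (gT : finGroupType) : Type := discrete_topology gT.

Section DiscreteGroup.
Variable gT : finGroupType.

HB.instance Definition _ := DiscreteTopology.on (discrete_group gT).
HB.instance Definition _ := Group.copy (discrete_group gT) gT.
HB.instance Definition _ := Finite.copy (discrete_group gT) gT.

Lemma nbhs_discrete_group (x : discrete_group gT) (A : set (discrete_group gT)) :
  nbhs x A <-> A x.
Proof.
split; first exact: nbhs_singleton.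
by move=> Ax; apply: open_nbhs_nbhs; split => //; exact: discrete_open.
Qed.

Let mulg_continuous_discrete :
  continuous (fun x : discrete_group gT * discrete_group gT => x.1 * x.2).
Proof.
move=> [x y] A /nbhs_discrete_group Axy.
exists ([set x], [set y]) => /=; first by split; exact/nbhs_discrete_group.
by move=> [a b] /= [-> ->].
Qed.

Let invg_continuous_discrete : continuous (fun x : discrete_group gT => x^-1).
Proof.
by move=> x A /nbhs_discrete_group Ax; exact/nbhs_discrete_group.
Qed.

HB.instance Definition _ := Group_isTopologicalGroup.Build (discrete_group gT)
  mulg_continuous_discrete invg_continuous_discrete.

Lemma profinite_discrete_group : profinite (discrete_group gT).
Proof.
split.
- by apply: finite_compact; exact: finite_finset.
- move=> x y /(_ [set x] [set y]) [||z [/= -> //]]; exact/nbhs_discrete_group.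
- exact: zero_dimension_totally_disconnected discrete_zero_dimension.
Qed.

(** The index of a subgroup divides the order of the group. The rest matches [left_cosets], a set of
    sets, with the finite set [lcosets]. *)
Lemma pro_p_discrete_group (p : nat) :
  p.-group [set: gT]%G -> pro_p p (discrete_group gT).
Proof.
move=> pG; split; first exact: profinite_discrete_group.
move=> N _ /normal_subgroup_closed[N1 NM _ _].
have gNset : group_set (finset (fun x : gT => `[< N x >])).
  apply/group_setP; split.
    by rewrite !inE.
  by move=> x y; rewrite !inE; exact: NM.
pose H := Group gNset.
pose D := lcosets H [set: gT]%G.
have Dp : p.-nat #|D| by rewrite card_lcosets; apply: pnat_dvd (dvdn_indexg _ _) pG.
exists (logn p #|D|); rewrite -p_part (part_pnat_id Dp).
have -> : left_cosets N = (fun i => [set` enum_val i]) @` [set: 'I_#|D|].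
  apply/seteqP; split=> [_ [x _ <-]|_ [i _ <-]].
    have Dx : x *: H \in D by apply/lcosetsP; exists x; rewrite ?inE.
    exists (enum_rank_in Dx (x *: H)) => //; rewrite enum_rankK_in //.
    apply/seteqP; split=> y.
      by move=> /= /lcosetP[n]; rewrite !inE => Nn ->; exists n.
    by case=> n Nn <-; apply/lcosetP; exists n; rewrite ?inE //; exact/asboolP.
  have /lcosetsP[x _ ix] : enum_val i \in D by exact: enum_valP.
  exists x => //; rewrite ix; apply/seteqP; split=> y.
    by case=> n Nn <-; apply/lcosetP; exists n; rewrite ?inE //; exact/asboolP.
  by move=> /= /lcosetP[n]; rewrite !inE => Nn ->; exists n.
apply: card_eq_trans (inj_card_eq _) _; last by rewrite card_eq_sym; exact: card_II.
move=> i j _ _ /seteqP[ij ji]; apply: enum_val_inj.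
by apply/setP => x; apply/idP/idP => [/ij|/ji].
Qed.

End DiscreteGroup.

Lemma morph_continuous_discrete (G : topologicalGroupType) (gT : finGroupType)
    (f : G -> discrete_group gT) :
  {morph f : x y / x * y} -> nbhs (1 : G) [set x | f x = 1] -> continuous_hom f.
Proof.
move=> fM f1; split=> // x A /nbhs_discrete_group Afx.
have cx : {for x, continuous (fun y : G => x^-1 * y)}.
  by apply: continuousMg; [exact: cvg_cst|exact: cvg_id].
have : nbhs x ((fun y : G => x^-1 * y) @^-1` [set z | f z = 1]).
  by apply: cx; rewrite mulVg.
by apply: filterS => y /= fy; rewrite -(mulVKg x y) fM fy mulg1.
Qed.

Lemma discrete_group_continuous (gT hT : finGroupType)
    (f : discrete_group gT -> discrete_group hT) : continuous f.
Proof. by move=> x A /nbhs_discrete_group Ax; exact/nbhs_discrete_group. Qed.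

Lemma continuous_hom_discrete (G : topologicalGroupType) (gT hT : finGroupType)
    (f : G -> discrete_group gT) (h : gT -> hT) :
  continuous_hom f -> {morph h : x y / x * y} ->
  continuous_hom (fun x => h (f x) : discrete_group hT).
Proof.
move=> [fM cf] hM; split=> [x y|x]; first by rewrite fM; exact: hM.
apply: (@continuous_comp _ _ _ f (h : discrete_group gT -> discrete_group hT)).
  exact: cf.
exact: discrete_group_continuous.
Qed.

(** The quotient is realised as the permutations of the [p ^ k] cosets induced by right
    multiplication. This action is regular modulo [N], which gives both the order and the kernel. *)
Lemma pro_p_finite_quotient (p : nat) (G : topologicalGroupType) (N : set G) :
  prime p -> pro_p p G -> open N -> normal_subgroup N ->
  exists (gT : finGroupType) (f : G -> discrete_group gT),
    [/\ p.-group [set: gT]%G, continuous_hom f & forall x, f x = 1 <-> N x].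
Proof.
move=> p_pr [_ pG] oN nN; have [k] := pG N oN nN.
have [N1 NM NV NJ] := normal_subgroup_closed nN.
set n := (p ^ k)%N => /card_set_bijP[c [cn cI cS]].
pose coset x := [set x * y | y in N].
have cosetP x : left_cosets N (coset x) by exists x.
have cosetE x y : coset x = coset y <-> N (x^-1 * y).
  split=> [xy|Nxy].
    have : coset y y by exists 1 => //; rewrite mulg1.
    by rewrite -xy => -[z Nz <-]; rewrite mulKg.
  apply/seteqP; split=> _ [z Nz <-].
    exists (y^-1 * x * z); last by rewrite !mulgA mulgV mul1g.
    by apply: NM => //; have := NV _ Nxy; rewrite invgM invgK.
  by exists (x^-1 * y * z); [exact: NM|rewrite !mulgA mulgV mul1g].
pose pi x : 'I_n := Ordinal (cn _ (cosetP x)).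
have piE x y : pi x = pi y <-> N (x^-1 * y).
  rewrite -cosetE; split=> [/(congr1 val)/= /cI|xy].
    by apply; apply/mem_set.
  by apply: val_inj; rewrite /= xy.
(* Normality makes right multiplication well defined on left cosets. *)
have piR x y z : pi x = pi y -> pi (x * z) = pi (y * z).
  move=> /piE Nxy; apply/piE; have := NJ _ z Nxy.
  by rewrite conjgE invgM !mulgA.
have /choice[s sE] : forall i : 'I_n, exists x, pi x = i.
  move=> i; have [_ [x _ <-] xi] := cS i (ltn_ord i).
  by exists x; apply: val_inj.
have actI x : injective (fun i => pi (s i * x)).
  move=> i j /(piR _ _ x^-1); rewrite !mulgK => ij; by rewrite -(sE i) -(sE j).
pose rho x := perm (actI x).
have rhoE x y : rho x (pi y) = pi (y * x) by rewrite permE; apply: piR; rewrite sE.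
have rhoM : {morph rho : x y / x * y}.
  move=> x y; apply/permP => i; rewrite permM -(sE i) !rhoE mulgA //.
(* Regularity: the image of the trivial coset determines the permutation, so evaluation there counts
   [P]. *)
have rho1 x y : rho x (pi 1) = rho y (pi 1) -> rho x = rho y.
  rewrite !rhoE !mul1g => xy; apply/permP => i.
  rewrite -(sE i) !rhoE; apply/piE; move/piE: xy => Nxy.
  by rewrite invgM mulgA -(mulgA x^-1) mulVg mulg1.
pose P := finset (fun t : 'S_n => `[< exists x, rho x = t >]).
have inP x : rho x \in P by rewrite !inE; exists x.
have outP t : t \in P -> exists x, rho x = t by rewrite !inE.
have gP : group_set P.
  apply/group_setP; split.
    rewrite (_ : 1 = rho 1) ?inP //; apply/permP => i.
    by rewrite perm1 -(sE i) rhoE mulg1.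
  by move=> _ _ /outP[x <-] /outP[y <-]; rewrite -rhoM.
pose H := Group gP.
have cardP : #|P| = n.
  rewrite -[RHS]card_ord -cardsT.
  rewrite -(@card_in_imset _ _ (fun t : 'S_n => t (pi 1)) P); last first.
    by move=> _ _ /outP[x <-] /outP[y <-]; exact: rho1.
  apply: eq_card => i; rewrite [RHS]inE -(sE i); apply/imsetP.
  by exists (rho (s i)); rewrite ?inP // rhoE mul1g.
have ker x : subg H (rho x) = 1 <-> N x.
  have -> : N x <-> rho x = 1.
    have := piE 1 x; rewrite invg1 mul1g => <-.
    split=> [x1|x1]; last by rewrite -[x]mul1g -rhoE x1 perm1.
    apply/permP => i; rewrite perm1 -(sE i) rhoE; apply/piE.
    by rewrite invgM mulgVK; apply: NV; move/piE: x1; rewrite invg1 mul1g.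
  split=> [/(congr1 sgval)|->]; first by rewrite subgK ?inP.
  by rewrite morph1.
exists (subg_of H), (fun x => subg H (rho x)); split.
- by rewrite /pgroup -(card_isog (isog_subg H)) cardP pnatX pnat_id.
- apply: morph_continuous_discrete => [x y|]; first by rewrite rhoM subgM ?inP.
  suff -> : [set x | subg H (rho x) = 1] = N by apply: open_nbhs_nbhs.
  by apply/seteqP; split=> x /ker.
- exact: ker.
Qed.

(** * Semidirect products *)

Record linear_action (Q : finGroupType) (V : finZmodType) := LinearAction {
  lact :> Q -> V -> V;
  lact1 : forall v, lact 1 v = v;
  lactM : forall x y v, lact (x * y) v = lact x (lact y v);
  lactD : forall x u v, lact x (u + v)%R = (lact x u + lact x v)%R }.

Definition semidirect (Q : finGroupType) (V : finZmodType)
  (a : linear_action Q V) : Type := (V * Q)%type.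

Section Semidirect.
Variables (Q : finGroupType) (V : finZmodType) (a : linear_action Q V).

HB.instance Definition _ := Finite.copy (semidirect a) (V * Q)%type.

Let mul (s t : semidirect a) : semidirect a := ((s.1 + a s.2 t.1)%R, s.2 * t.2).
Let one : semidirect a := (0%R, 1).
Let inv (s : semidirect a) : semidirect a := (a s.2^-1 (- s.1)%R, s.2^-1).

Let mulA : associative mul.
Proof.
move=> s t u; rewrite /mul /=; congr (_, _); last by rewrite mulgA.
by rewrite lactD lactM addrA.
Qed.
Let mul1 : left_id one mul.
Proof. by case=> v x; rewrite /mul /= lact1 add0r mul1g. Qed.
Let mulV : left_inverse one inv mul.
Proof.
case=> v x; rewrite /mul /inv /one /= -lactD addNr mulVg; congr (_, _).
by apply: (@addrI _ (a x^-1 0%R)); rewrite -lactD !addr0.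
Qed.

HB.instance Definition _ := Finite_isGroup.Build (semidirect a) mulA mul1 mulV.

Lemma semidirectM (s t : semidirect a) :
  s * t = ((s.1 + a s.2 t.1)%R, s.2 * t.2).
Proof. by []. Qed.

Lemma pgroup_semidirect (p : nat) :
  p.-nat #|V| -> p.-group [set: Q]%G -> p.-group [set: semidirect a]%G.
Proof.
by move=> pV; rewrite /pgroup !cardsT card_prod pnatM pV.
Qed.

End Semidirect.

HB.instance Definition _ (U V : finZmodType) :=
  GRing.Zmodule.on (U * V)%type.
HB.instance Definition _ (I : finType) (V : finZmodType) :=
  GRing.Zmodule.on {ffun I -> V}.

Section HeisenbergAction.
Variable p : nat.

(** The semidirect product is the Heisenberg group: [((b, c), a)] is the upper unitriangular matrix
    with [a], [b] above the diagonal and [c] in the corner. As acting group ['F_p] is additive, so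
    its [1%g] is zero. *)
Let act (x : 'F_p) (v : 'F_p * 'F_p) : 'F_p * 'F_p := (v.1, v.2 + x * v.1)%R.

Fact heisenberg_act1 v : act 1%g v = v.
Proof. by case: v => b c; rewrite /act /= mul0r addr0. Qed.

Fact heisenberg_actM x y v : act (x * y)%g v = act x (act y v).
Proof. by rewrite /act /= mulrDl addrAC addrA. Qed.

Fact heisenberg_actD x u v : act x (u + v)%R = (act x u + act x v)%R.
Proof. by rewrite /act /= mulrDr addrACA. Qed.

Definition heisenberg_action :=
  @LinearAction 'F_p ('F_p * 'F_p)%type act
    heisenberg_act1 heisenberg_actM heisenberg_actD.
End HeisenbergAction.

(** A maximal subgroup of a [p]-group is normal of index [p]; take one containing [H] and identify
    the quotient with the additive group of ['F_p]. *)
Lemma pgroup_maximal_character (p : nat) (gT : finGroupType) (H G : {group gT}) :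
  prime p -> p.-group G -> H \proper G ->
  exists f : gT -> 'F_p,
    [/\ {in G &, {morph f : x y / x * y}},
        {in H, forall x, f x = 1} & exists2 x, x \in G & f x <> 1].
Proof.
move=> p_pr pG /andP[sHG nsGH].
have [HG|[M maxM sHM]] := maximal_exists sHG; first by rewrite HG subxx in nsGH.
have nMG := p_maximal_normal pG maxM.
have cardGM : #|G / M| = p.
  by rewrite card_quotient ?normal_norm // (p_maximal_index pG maxM).
have /isogP[f injf _] : isog (G / M)%G [set: 'F_p]%G.
  by rewrite isog_cyclic_card ?prime_cyclic ?cardGM ?cardsT ?card_Fp /=.
have memG x : x \in G -> coset M x \in (G / M)%g by exact: mem_quotient.
have nMx x : x \in G -> x \in 'N(M) by have /fintype.subsetP := normal_norm nMG; exact.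
exists (fun x => f (coset M x)); split.
- by move=> x y Gx Gy; rewrite !morphM ?memG ?nMx.
- by move=> x Hx; rewrite coset_id ?morph1 //; exact: (fintype.subsetP sHM).
have /fintype.properP[_ [x Gx nMx']] := maxgroupp maxM.
exists x => // fx; case/negP: nMx'.
by rewrite coset_idr ?nMx //; apply: (injmP injf); rewrite ?memG ?group1 ?morph1.
Qed.

Section RegularAction.
Variables (K : finGroupType) (V : finZmodType).

(** The semidirect product for this translation action is the regular wreath product of [V] with
    [K]. *)
Let act (x : K) (v : {ffun K -> V}) : {ffun K -> V} := [ffun y => v (x^-1 * y)].

Fact regular_act1 v : act 1 v = v.
Proof. by apply/ffunP => y; rewrite ffunE invg1 mul1g. Qed.

Fact regular_actM x y v : act (x * y) v = act x (act y v).
Proof. by apply/ffunP => j; rewrite !ffunE invgM mulgA. Qed.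

Fact regular_actD x u v : act x (u + v)%R = (act x u + act x v)%R.
Proof. by apply/ffunP => j; rewrite !ffunE. Qed.

Definition regular_action :=
  @LinearAction K {ffun K -> V} act regular_act1 regular_actM regular_actD.
End RegularAction.

Lemma sum_periodic (V : zmodType) (q n : nat) (w : nat -> V) :
  (forall i, w (q + i)%N = w i) ->
  (\sum_(0 <= i < n * q) w i = (\sum_(0 <= i < q) w i) *+ n)%R.
Proof.
move=> wq; elim: n => [|n IH]; first by rewrite mul0n big_geq.
rewrite mulSn (@big_cat_nat _ _ _ q) ?leq_addr //= mulrS; congr (_ + _)%R.
by rewrite -{1}[q]add0n big_addn addKn -IH; apply: eq_bigr => i _; rewrite addnC wq.
Qed.

Lemma sum_periodic_Fp (p q : nat) (w : nat -> 'F_p) :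
  prime p -> (forall i, w (q + i)%N = w i) ->
  (\sum_(0 <= i < p * q) w i = 0)%R.
Proof.
move=> p_pr wq; rewrite sum_periodic //; apply: mulrn_pchar; exact: pchar_Fp.
Qed.

Lemma commute_regular_semidirect (p : nat) (Q C : finGroupType) (x y : Q) (g : C)
    (s : semidirect (regular_action (Q * C)%type 'F_p)) :
  prime p -> #[g] = (p * #|Q|)%N ->
  commute s ([ffun k : Q * C => (k == 1%g)%:R%R], (x, 1)) ->
  commute s (0%R, (y, g)) ->
  s.2.1 = 1.
Proof.
case: s => v [z c] p_pr og sx sy /=; apply/eqP/negPn/negP => z1.
pose H := semidirect (regular_action (Q * C)%type 'F_p).
have vy k : v k = v ((y, g)^-1 * k).
  move: sy; rewrite /commute => /(congr1 (fun t : H => t.1 k)).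
  by rewrite !semidirectM /= !ffunE /= addr0 add0r.
have vx k : (v k + (((z, c)^-1 * k)%g == 1%g)%:R =
             (k == 1%g)%:R + v ((x, 1)^-1 * k)%g)%R.
  move: sx; rewrite /commute => /(congr1 (fun t : H => t.1 k)).
  by rewrite !semidirectM /= !ffunE.
have vyn n k : v k = v ((y, g) ^- n * k).
  elim: n k => [|n IH] k; first by rewrite expg0 invg1 mul1g.
  by rewrite expgS invgM -mulgA -IH -vy.
(* As [y ^+ #|Q| = 1], the power [(y, g) ^+ #|Q|] moves only the second coordinate. So [v] has
   period [#|Q|] along each row, and the [p] periods in a row sum to zero in ['F_p]. *)
have vq a i : v (a, g ^+ (#|Q| + i)) = v (a, g ^+ i).
  have pairX n : (y, g) ^+ n = (y ^+ n, g ^+ n).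
    by elim: n => // n IH; rewrite !expgS IH.
  have yQ : y ^+ #|Q| = 1.
    by apply/eqP; rewrite -order_dvdn -cardsT order_dvdG ?inE.
  rewrite (vyn #|Q|) pairX yQ; congr (v (_, _)) => /=.
    by rewrite invg1 mul1g.
  by rewrite expgnDr mulKg.
have vsum a : (\sum_(0 <= i < p * #|Q|) v (a, (g ^+ i)%g) = 0)%R.
  by apply: sum_periodic_Fp.
(* Sum [vx] over the row through [1]. Both sums of [v] vanish; the left delta vanishes since
   [z <> 1]; the right one is met only at [i = 0], because [g] has order [p * #|Q|]. *)
pose k i : Q * C := (1, g ^+ i).
have : (\sum_(0 <= i < p * #|Q|) (v (k i) + (((z, c)^-1 * k i)%g == 1%g)%:R) =
  \sum_(0 <= i < p * #|Q|) ((k i == 1%g)%:R + v ((x, 1)^-1 * k i)%g))%R.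
  by apply: eq_bigr => i _; exact: vx.
rewrite !big_split /= vsum add0r big1 => [|i _]; last first.
  case: eqP => // -[] /= /eqP; rewrite mulg1 invg_eq1 => z0.
  by rewrite z0 in z1.
rewrite [X in (_ + X)%R](eq_bigr (fun i => v (x^-1, (g ^+ i)%g))); last first.
  by move=> i _; congr (v (_, _)); rewrite /= ?mulg1 ?invg1 ?mul1g.
have pq0 : (0 < p * #|Q|)%N by rewrite -og order_gt0.
rewrite vsum addr0 big_ltn //.
rewrite /k expg0 eqxx big_nat big1 => [|i /andP[i0 ipq]]; last first.
  case: eqP => // -[] /eqP; rewrite -order_dvdn og => /dvdn_leq.
  by rewrite i0 leqNgt ipq => /(_ isT).
by move/eqP; rewrite addr0 eq_sym oner_eq0.
Qed.

(** * Commuting subgroups of free pro-p groups *)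

(** For a pro-[p] group this is topological density, tested on finite [p]-group images. *)
Definition pro_p_dense (p : nat) (F : topologicalGroupType) (M : set F) : Prop :=
  forall (gT : finGroupType) (f : F -> discrete_group gT) (x : F),
    p.-group [set: gT]%G -> continuous_hom f -> (f @` M) (f x).

(** Some continuous [f] to a finite [p]-group has [f(M)] smaller than [f(F)]. Being finite and
    closed under products, both are subgroups, so a character of [f(F)] killing [f(M)] can be
    composed with [f]. *)
Lemma character_of_nondense (p : nat) (F : topologicalGroupType) (M : set F) :
  prime p -> M 1 -> (forall y z, M y -> M z -> M (y * z)) ->
  ~ pro_p_dense p M ->
  exists a : F -> discrete_group 'F_p,
    [/\ continuous_hom a, forall y, M y -> a y = 1 & exists y, a y <> 1].
Proof.
move=> p_prime M1 MM.
move=> /existsNP[gT /existsNP[f /existsNP[x /not_implyP[pT /not_implyP[cf nfx]]]]].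
move: cf => [fM cf].
have f1 := hom1 fM.
pose P := finset (fun t : gT => `[< exists y, f y = t >]).
pose Q := finset (fun t : gT => `[< (f @` M) t >]).
have gP : group_set P.
  apply/group_setP; split; first by rewrite !inE; exists 1.
  move=> s t; rewrite !inE => -[y <-] [z <-]; by exists (y * z); rewrite fM.
have gQ : group_set Q.
  apply/group_setP; split; first by rewrite !inE; exists 1.
  move=> s t; rewrite !inE => -[y My <-] [z Mz <-].
  by exists (y * z); [exact: MM|rewrite fM].
have [] := @pgroup_maximal_character p gT (Group gQ) (Group gP) p_prime.
- by apply: pgroupS pT; exact: finset.subsetT.
- apply/fintype.properP; split.
    by apply/fintype.subsetP => t; rewrite !inE => -[y _ <-]; exists y.
  by exists (f x); rewrite !inE; [exists x|exact/asboolP].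
move=> h [hM hH [t Pt]]; have [y <-] : exists y, f y = t by move: Pt; rewrite !inE.
move=> hfy.
have inP z : f z \in P by rewrite !inE; exists z.
exists (h \o f); split.
- apply: morph_continuous_discrete => [y1 y2|]; first by rewrite /= fM hM.
  have : nbhs (1 : F) (f @^-1` [set 1]).
    by apply: cf; rewrite f1; exact/nbhs_discrete_group.
  apply: filterS => z /= ->; apply: hH; rewrite !inE; by exists 1.
- by move=> z Mz; apply: hH; rewrite !inE; exists z.
- by exists y.
Qed.

Section FreeProP.
Variables (p : nat) (F : topologicalGroupType) (X : Type) (iota : X -> F).
Hypotheses (p_prime : prime p) (freeF : is_free_pro_p p iota).

Lemma pro_p_separated (z : F) : z <> 1 ->
  exists (gT : finGroupType) (f : F -> discrete_group gT),
    [/\ p.-group [set: gT]%G, continuous_hom f & f z <> 1].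
Proof.
have [pF _ _] := freeF.
move=> /(profinite_separated pF.1)[N [oN nN Nz]].
have [gT [f [pT cf ker]]] := pro_p_finite_quotient p_prime pF oN nN.
by exists gT, f; split=> // /ker.
Qed.

Lemma free_support (gT : finGroupType) (f : F -> discrete_group gT) :
  continuous_hom f -> cofinite_set [set x | f (iota x) = 1].
Proof.
have [_ ci _] := freeF.
move=> [fM cf]; apply: (ci (f @^-1` [set 1])).
have f1 := hom1 fM.
by apply: cf; rewrite f1; exact/nbhs_discrete_group.
Qed.

Lemma free_unique (gT : finGroupType) (f g : F -> discrete_group gT) :
  p.-group [set: gT]%G -> continuous_hom f -> continuous_hom g ->
  (forall x, f (iota x) = g (iota x)) -> f =1 g.
Proof.
have [_ ci univ] := freeF.
move=> pT cf cg fg z.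
have cfi : converges_to_1 (f \o iota).
  move=> U /nbhs_discrete_group U1; apply: sub_cofinite_set (free_support cf).
  by move=> x /= ->.
have [h [_ hU]] := univ _ _ (pro_p_discrete_group pT) cfi.
rewrite -(hU f) // -(hU g) //; split=> //.
by apply/funext => x /=; rewrite fg.
Qed.

Lemma free_extend (gT : finGroupType) (f : X -> gT) :
  p.-group [set: gT]%G -> cofinite_set [set x | f x = 1] ->
  exists2 phi : F -> discrete_group gT,
    continuous_hom phi & forall x, phi (iota x) = f x.
Proof.
have [_ ci univ] := freeF.
move=> pT cf.
have cfi : converges_to_1 (f : X -> discrete_group gT).
  move=> U /nbhs_discrete_group U1; apply: sub_cofinite_set cf.
  by move=> x /= ->.
have [phi [[cphi phif] _]] := univ _ _ (pro_p_discrete_group pT) cfi.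
by exists phi => // x; rewrite -phif.
Qed.

(** Lift [a] and [b] to the Heisenberg group, with corner [0] on generators. The corner of
    [phi x * phi y] is the sum of the two corners plus [a x * b y]; swapping [x] and [y] must not
    change it. *)
Lemma commute_characters (a b : F -> discrete_group 'F_p) (x y : F) :
  continuous_hom a -> continuous_hom b -> commute x y ->
  ((a x : 'F_p) * b y = a y * (b x : 'F_p))%R.
Proof.
move=> ca cb xy.
pose H := semidirect (heisenberg_action p).
have pFp : p.-nat #|'F_p| by rewrite card_Fp // pnat_id.
have pH : p.-group [set: H]%G.
  by apply: pgroup_semidirect; rewrite ?card_prod ?pnatM ?pFp // /pgroup cardsT.
have [|phi cphi phif] := @free_extend H
    (fun i => ((b (iota i) : 'F_p, 0%R), (a (iota i) : 'F_p))) pH.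
  have : cofinite_set ([set i | a (iota i) = 1] `&` [set i | b (iota i) = 1]).
    rewrite setCI finite_setU.
    by split; [exact: (free_support ca)|exact: (free_support cb)].
  by apply: sub_cofinite_set => i [/= -> ->].
have pFpG : p.-group [set: 'F_p]%G by rewrite /pgroup cardsT.
have phia : (fun z => (phi z).2) =1 a.
  apply: (free_unique pFpG) => // [|i]; last by rewrite phif.
  exact: (@continuous_hom_discrete _ H 'F_p phi snd).
have phib : (fun z => (phi z).1.1) =1 b.
  apply: (free_unique pFpG) => // [|i]; last by rewrite phif.
  exact: (@continuous_hom_discrete _ H 'F_p phi (fun s => s.1.1)).
have [phiM _] := cphi.
have : phi x * phi y = phi y * phi x by rewrite -!phiM xy.
move=> /(congr1 (fun s => s.1.2)); rewrite /= -(phia x) -(phia y) -(phib x) -(phib y).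
by rewrite addrCA => /addrI/addrI.
Qed.

(** By density, [phi z] commutes with the whole image of [phi], in particular with the images of the
    generators [x0] and [y0], which suffices for [commute_regular_semidirect]. *)
Lemma centralizer_of_dense (M : set F) (z : F) (x0 y0 : X) :
  x0 <> y0 -> pro_p_dense p M -> (forall m, M m -> commute z m) -> z = 1.
Proof.
move=> xy dM cM; apply: contrapT => z1.
have [Q [rho [pQ crho rhoz]]] := pro_p_separated z1.
have pQ' : p.-nat #|Q| by rewrite -cardsT.
have [C [g [og pC]]] : exists (C : finGroupType) (g : C),
    #[g] = (p * #|Q|)%N /\ p.-nat #|C|.
  have Q_gt0 : (0 < #|Q|)%N by apply/card_gt0P; exists 1.
  (* ['Z_n] has [n] elements only when [n > 1]. *)
  have pQ_gt1 : (1 < p * #|Q|)%N.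
    by apply: leq_trans (prime_gt1 p_prime) _; rewrite leq_pmulr.
  exists 'Z_(p * #|Q|), Zp1.
  by rewrite order_Zp1 card_ord Zp_cast // pnatM pnat_id.
pose K : finGroupType := (Q * C)%type.
have pK : p.-group [set: K]%G.
  by rewrite /pgroup cardsT card_prod pnatM pQ'.
pose H := semidirect (regular_action K 'F_p).
have pH : p.-group [set: H]%G.
  by apply: pgroup_semidirect; rewrite // card_ffun pnatX card_Fp // pnat_id.
pose delta : {ffun K -> 'F_p} := [ffun k => (k == 1%g)%:R%R].
(* A lift of [rho] altered only at [x0] and [y0], so that cofinitely many generators still go to
   [1]. *)
pose f (i : X) : H :=
  if `[< i = x0 >] then (delta, (rho (iota i), 1))
  else if `[< i = y0 >] then (0%R, (rho (iota i), g))
  else (0%R, (rho (iota i), 1)).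
have frho i : (f i).2.1 = rho (iota i) by rewrite /f; case: ifP => // _; case: ifP.
have fx0 : f x0 = (delta, (rho (iota x0) : Q, 1)).
  by rewrite /f; case: asboolP.
have fy0 : f y0 = (0%R, (rho (iota y0) : Q, g)).
  by rewrite /f; case: asboolP => [/esym//|_]; case: asboolP.
have [|phi cphi phif] := free_extend pH (f := f).
  have : cofinite_set ([set i | rho (iota i) = 1] `&` ~` [set x0; y0]).
    rewrite setCI setCK finite_setU; split; last exact: finite_set2.
    exact: (free_support crho).
  apply: sub_cofinite_set => i [/= rhoi /not_orP[ix iy]].
  by rewrite /f; case: asboolP => // _; case: asboolP => // _; rewrite rhoi.
have phirho : (fun t => (phi t).2.1) =1 rho.
  apply: (free_unique pQ) => // [|i]; last by rewrite phif frho.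
  exact: (@continuous_hom_discrete _ H Q phi (fun s => s.2.1)).
have phiz i : commute (phi z) (f i).
  have [m Mm <-] : (phi @` M) (f i) by rewrite -phif; exact: dM.
  by have [phiM _] := cphi; rewrite /commute -!phiM (cM m Mm).
have cx := phiz x0; have cy := phiz y0.
rewrite fx0 in cx; rewrite fy0 in cy.
apply: rhoz; rewrite -phirho.
exact: (@commute_regular_semidirect p Q C (rho (iota x0)) (rho (iota y0)) g
  (phi z) p_prime og cx cy).
Qed.

Lemma free_pro_p_commuting_factors (N M : set F) (x0 y0 : X) :
  x0 <> y0 ->
  N 1 -> (forall y z, N y -> N z -> N (y * z)) ->
  M 1 -> (forall y z, M y -> M z -> M (y * z)) ->
  (forall n m, N n -> M m -> commute n m) ->
  (forall x, exists n m, [/\ N n, M m & x = n * m]) ->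
  (forall n, N n -> n = 1) \/ (forall m, M m -> m = 1).
Proof.
move=> xy N1 NM M1 MM cNM NMF.
have [dM|ndM] := pselect (pro_p_dense p M).
  left=> n Nn; apply: (centralizer_of_dense xy dM) => m Mm.
  exact: cNM.
have [dN|ndN] := pselect (pro_p_dense p N).
  right=> m Mm; apply: (centralizer_of_dense xy dN) => n Nn.
  exact/commute_sym/cNM.
have [a [ca aM [x ax]]] := character_of_nondense p_prime M1 MM ndM.
have [b [cb bN [y bY]]] := character_of_nondense p_prime N1 NM ndN.
have [n [m [Nn Mm xE]]] := NMF x.
have [n' [m' [Nn' Mm' yE]]] := NMF y.
(* Here [a n = a x] and [b m' = b y] are nonzero, while [a m'] is zero, so the relation makes a
   product of nonzero field elements vanish. *)
have := commute_characters ca cb (cNM _ _ Nn Mm').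
rewrite (aM _ Mm') mul0r => /eqP; rewrite mulf_eq0 => /orP[/eqP an|/eqP bm].
  by case: ax; rewrite xE ca.1 an mul1g aM.
by case: bY; rewrite yE cb.1 bm mulg1 bN.
Qed.

(** The generator [iota x0] is detected by the character that is one at [x0] and zero at all other
    generators. *)
Lemma free_pro_p_nontrivial (x0 : X) : exists z : F, z <> 1.
Proof.
pose h (x : X) : 'F_p := if `[< x = x0 >] then 1%R else 0%R.
have pFp : p.-group [set: 'F_p]%G by rewrite /pgroup cardsT card_Fp // pnat_id.
have [|phi [phiM _] phih] := free_extend pFp (f := h).
  apply: sub_finite_set (finite_set1 x0) => x /=; rewrite /h.
  by case: asboolP.
exists (iota x0) => z1; have := phih x0.
rewrite z1 (hom1 phiM).
by rewrite /h; case: asboolP => // _ /eqP; rewrite eq_sym oner_eq0.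
Qed.

End FreeProP.

(** * Cancellation *)

Section ContinuousHom.
Variables G H K : topologicalGroupType.

Lemma continuous_hom_comp (f : G -> H) (g : H -> K) :
  continuous_hom f -> continuous_hom g -> continuous_hom (fun x => g (f x)).
Proof.
move=> [fM cf] [gM cg]; split=> [x y|x]; first by rewrite fM gM.
by apply: (@continuous_comp _ _ _ f g); [exact: cf|exact: cg].
Qed.

Lemma continuous_hom_fst : continuous_hom (fun x : G * H => x.1).
Proof. by split=> // x; exact: cvg_fst. Qed.

Lemma continuous_hom_snd : continuous_hom (fun x : G * H => x.2).
Proof. by split=> // x; exact: cvg_snd. Qed.

Lemma continuous_hom_inl : continuous_hom (fun x : G => (x, 1 : H)).
Proof.
split=> [x y|x]; first by congr (_, _); rewrite mulg1.
by apply: cvg_pair; [exact: cvg_id|exact: cvg_cst].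
Qed.

Lemma continuous_hom_inr : continuous_hom (fun x : H => (1 : G, x)).
Proof.
split=> [x y|x]; first by congr (_, _); rewrite mulg1.
by apply: cvg_pair; [exact: cvg_cst|exact: cvg_id].
Qed.

Lemma continuous_hom_mul (f g : G -> H) :
  continuous_hom f -> continuous_hom g -> (forall x y, commute (f x) (g y)) ->
  continuous_hom (fun x => f x * g x).
Proof.
move=> [fM cf] [gM cg] fg; split=> [x y|x].
  by rewrite fM gM !mulgA -(mulgA (f x) (f y)) (fg y x) mulgA.
by apply: continuousMg; [exact: cf|exact: cg].
Qed.
End ContinuousHom.

Section Swap.
Variables F A B : topologicalGroupType.
Variable f : F * A -> F * B.
Hypothesis cf : continuous_hom f.

(* With [f (1, a) = (s a, t a)] and [f (c, 1) = (1, u c)], this is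
   [a |-> t a * u (s a)]. *)
Definition swap_hom (a : A) : B := (f (1, a)).2 * (f ((f (1, a)).1, 1)).2.

Lemma continuous_hom_inr_fst : continuous_hom (fun a => (f (1, a)).1).
Proof.
apply: continuous_hom_comp (continuous_hom_fst _ _).
exact: continuous_hom_comp (continuous_hom_inr _ _) cf.
Qed.

Lemma continuous_hom_inr_snd : continuous_hom (fun a => (f (1, a)).2).
Proof.
apply: continuous_hom_comp (continuous_hom_snd _ _).
exact: continuous_hom_comp (continuous_hom_inr _ _) cf.
Qed.

Lemma continuous_hom_inl_snd : continuous_hom (fun c => (f (c, 1)).2).
Proof.
apply: continuous_hom_comp (continuous_hom_snd _ _).
exact: continuous_hom_comp (continuous_hom_inl _ _) cf.
Qed.

Lemma commute_factors (a : A) (c : F) : commute (f (1, a)).2 (f (c, 1)).2.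
Proof.
have : (1, a) * (c, 1) = (c, 1) * (1, a) :> F * A.
  by congr (_, _); rewrite /= ?mulg1 ?mul1g.
by move=> /(congr1 f)/(congr1 snd); rewrite !cf.1.
Qed.

Lemma swap_hom_continuous : continuous_hom swap_hom.
Proof.
apply: continuous_hom_mul => [||x y]; [exact: continuous_hom_inr_snd| |exact: commute_factors].
exact: continuous_hom_comp continuous_hom_inr_fst continuous_hom_inl_snd.
Qed.
End Swap.

(** Put [f (1, a) = (s, t)]. As [g] returns [f (s, 1)] to [(s, 1)], the image under [g] of
    [(1, swap_hom f a)] has first coordinate [s] and second coordinate that of [g (1, t)].
    Multiplying the latter by that of [g (s, 1)] gives [a], since [g (s, 1) * g (1, t) = (1, a)]. *)
Lemma swap_homK (F A B : topologicalGroupType)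
    (f : F * A -> F * B) (g : F * B -> F * A) :
  continuous_hom f -> continuous_hom g -> cancel f g ->
  (forall c, (f (c, 1)).1 = 1) -> (forall c, (g (c, 1)).1 = 1) ->
  cancel (swap_hom f) (swap_hom g).
Proof.
move=> [fM _] cg fK f1 g1 a; have [gM _] := cg.
rewrite /swap_hom; set s := (f (1, a)).1; set t := (f (1, a)).2.
have gu : g (1, (f (s, 1)).2) = (s, 1) by rewrite -(f1 s) -surjective_pairing fK.
have gt : g (s, 1) * g (1, t) = (1, a).
  rewrite -gM -(fK (1, a)); congr g; rewrite [RHS]surjective_pairing.
  by congr (_, _); rewrite /= ?mulg1 ?mul1g.
have gtu : g (1, t * (f (s, 1)).2) = g (1, t) * (s, 1).
  by rewrite -[X in _ = _ * X]gu -gM; congr (g (_, _)); rewrite /= mulg1.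
have gt1 : (g (1, t)).1 = 1 by move/(congr1 fst): gt; rewrite /= g1 mul1g.
move/(congr1 snd): gt; rewrite gtu /= gt1 mul1g mulg1 => <-.
exact: commute_factors.
Qed.

Lemma common_factorK (F A B : topologicalGroupType)
    (f : F * A -> F * B) (g : F * B -> F * A) :
  cancel f g -> (forall a, (f (1, a)).1 = 1) ->
  cancel (fun a => (f (1, a)).2) (fun b => (g (1, b)).2).
Proof.
move=> fK f1 a.
suff -> : (1, (f (1, a)).2) = f (1, a) by rewrite fK.
by rewrite [RHS]surjective_pairing f1.
Qed.

Theorem corollary23 (p : nat) (F : topologicalGroupType) (X : Type)
    (p_prime : prime p)
    (F_free : free_pro_p_of_rank p F X)
    (rank_gt1 : ~ ([set: X] #<= `I_1)%card) :
  profinite_cancellable F.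
Proof.
have [iota freeF] := F_free.
have [x0 [y0 xy]] : exists x0 y0 : X, x0 <> y0.
  apply: contrapT => nxy; apply: rank_gt1.
  have eqX (x y : X) : x = y by apply: contrapT => xy; apply: nxy; exists x, y.
  have [[x _]|nX] := pselect (exists x : X, True).
    rewrite -(card_le_eqr (card_set1 (x := x))).
    by apply: subset_card_le => y _; exact: eqX.
  rewrite (_ : [set: X] = set0) ?card_ge0 //; apply/seteqP; split=> // x _.
  by apply: nX; exists x.
(* The projections to [F] of the images of [C] and of [F] commute, and together they give all of [F]
   because [f] is onto; so one of them is trivial. *)
have dich (C D : topologicalGroupType) (f : F * C -> F * D) (g : F * D -> F * C) :
    continuous_hom f -> cancel g f ->
    (forall a, (f (1, a)).1 = 1) \/ (forall c, (f (c, 1)).1 = 1).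
  move=> [fM _] gK.
  have f1 := hom1 fM.
  pose N := range (fun a => (f (1, a)).1); pose M := range (fun c => (f (c, 1)).1).
  have := @free_pro_p_commuting_factors p F X iota p_prime freeF N M x0 y0 xy.
  case.
  - by exists 1 => //; rewrite (_ : (1, 1) = 1) // f1.
  - move=> _ _ [a _ <-] [a' _ <-]; exists (a * a') => //.
    by rewrite -[RHS]/((f (1, a) * f (1, a')).1) -fM; congr (f (_, _)).1; rewrite mulg1.
  - by exists 1 => //; rewrite (_ : (1, 1) = 1) // f1.
  - move=> _ _ [a _ <-] [a' _ <-]; exists (a * a') => //.
    by rewrite -[RHS]/((f (a, 1) * f (a', 1)).1) -fM; congr (f (_, _)).1; rewrite mulg1.
  - move=> _ _ [a _ <-] [c _ <-].
    have : (1, a) * (c, 1) = (c, 1) * (1, a) :> F * C.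
      by congr (_, _); rewrite /= ?mulg1 ?mul1g.
    by move=> /(congr1 f)/(congr1 fst); rewrite !fM.
  - move=> x; case E : (g (x, 1)) => [c a].
    exists (f (1, a)).1, (f (c, 1)).1; split; [by exists a|by exists c|].
    have -> : (f (1, a)).1 * (f (c, 1)).1 = (f (c, a)).1.
      rewrite -[LHS]/((f (1, a) * f (c, 1)).1) -fM; congr (f (_, _)).1;
      by rewrite /= ?mulg1 ?mul1g.
    by rewrite -E gK.
  - by move=> N1; left=> a; apply: N1; exists a.
  - by move=> M1; right=> c; apply: M1; exists c.
move=> A B _ _ [f [g [cf cg fK gK]]].
have [z z1] := free_pro_p_nontrivial p_prime freeF x0.
(* If [k] sends [(z, 1)] into the factor [C] and [h] sends [C] into [D], then
   [(z, 1) = h (k (z, 1))] has trivial first coordinate. *)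
have mixed (C D : topologicalGroupType) (h : F * C -> F * D) (k : F * D -> F * C) :
    cancel k h -> (forall a, (h (1, a)).1 = 1) -> (forall c, (k (c, 1)).1 = 1) -> False.
  move=> kK h1 k1; apply: z1; have := h1 (k (z, 1)).2.
  by rewrite -(k1 z) -surjective_pairing kK.
(* Either [f] and [g] restrict to inverse maps between [A] and [B], or both send [F] into the other
   factor and [swap_hom] applies; the two mixed cases contradict [z <> 1]. *)
have [fA|fF] := dich _ _ _ _ cf gK; have [gA|gF] := dich _ _ _ _ cg fK.
- exists (fun a => (f (1, a)).2), (fun b => (g (1, b)).2); split.
  + exact: continuous_hom_inr_snd.
  + exact: continuous_hom_inr_snd.
  + exact: common_factorK fK fA.
  + exact: common_factorK gK gA.
- by have := mixed _ _ _ _ gK fA gF.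
- by have := mixed _ _ _ _ fK gA fF.
- exists (swap_hom f), (swap_hom g); split.
  + exact: swap_hom_continuous.
  + exact: swap_hom_continuous.
  + exact: swap_homK.
  + exact: swap_homK.
Qed.
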